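(* For all integers $1\leq l\leq s\leq n$, $$p_{n;\leq s}^l=s^{n-1}-\sum_{i=0}^{l-2}\binom{n-1}{i}p_i\,(s-i-1)^{n-i-1}-\sum_{i=l}^{s-2}\binom{n-1}{i-1}p_i^l\,(s-i-1)^{n-i}.$$
   Context: There are $n$ parking spaces in a line numbered $1,\dots,n$ and $n$ cars arriving in order $1,\dots,n$; car $j$ has preference $a_j\in[n]$ and parks in the first unoccupied space numbered $\geq a_j$, if any. The sequence $(a_1,\dots,a_n)$ is a parking function of length $n$ if all cars park. $p_i=(i+1)^{i-1}$ is the number of parking functions of length $i$ (with $p_0=1$); $p_i^l$ is the number of parking functions $(a_1,\dots,a_i)$ of length $i$ with $a_1=l$. $p_{n;\leq s}^l$ is the number of parking functions $(a_1,\dots,a_n)$ of length $n$ with $a_1=l$ and $a_j\leq s$ for all $j$. *)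

(* Defs.v *)
From mathcomp Require Import all_boot all_order all_algebra.

Set Implicit Arguments.
Unset Strict Implicit.
Unset Printing Implicit Defensive.

(* Spaces are numbered 1, ..., n; occ lists the occupied ones.  The value is  *)
(* None when every space numbered >= a is taken.                              *)
Definition parking_space (n : nat) (occ : seq nat) (a : nat) : option nat :=
  ohead [seq k <- iota 1 n | (a <= k) && (k \notin occ)].

Fixpoint all_park (n : nat) (occ prefs : seq nat) : bool :=
  if prefs is a :: prefs' then
    if parking_space n occ a is Some k then all_park n (k :: occ) prefs'
    else false
  else true.

(* Elements of 'I_n are 0-based, hence the shift to the values 1, ..., n.     *)
Definition preferences (n : nat) (t : n.-tuple 'I_n) : seq nat :=
  [seq (val x).+1 | x <- t].

Definition parking_function (n : nat) (t : n.-tuple 'I_n) : bool :=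
  all_park n [::] (preferences t).

Definition num_pf (n : nat) : nat :=
  #|[set t : n.-tuple 'I_n | parking_function t]|.

(* The default 0 of head only matters for n = 0, and is not a space number.   *)
Definition num_pf_first (n l : nat) : nat :=
  #|[set t : n.-tuple 'I_n |
      parking_function t && (head 0 (preferences t) == l)]|.

Definition num_pf_first_le (n s l : nat) : nat :=
  #|[set t : n.-tuple 'I_n |
      [&& parking_function t, head 0 (preferences t) == l
        & all (fun a => a <= s) (preferences t)]]|.

(* Main.v *)
Require Import Defs.
From mathcomp Require Import all_boot all_order all_algebra.
From mathcomp Require Import zify.
Import GRing.Theory.

(** A preference word of length n is a parking function iff, for every k <= n,
at least k letters are <= k.  If a word over {1, ..., s} with first letter l
is not a parking function, let i + 1 be the least k violating this condition:
exactly i letters are <= i, they form a parking function of length i, no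
letter equals i + 1, and the other letters are arbitrary in {i + 2, ..., s}.
Choosing the positions of the i small letters (the first position is one of
them iff l <= i) gives the two sums, which are subtracted from the total
number s ^ (n - 1) of words. *)

(** * Counting criterion for parking functions *)

Definition enough_small (n : nat) (w : seq nat) : bool :=
  all (fun k => k <= count (leq^~ k) w) (iota 0 n.+1).

Lemma enough_smallP n w :
  reflect (forall k, k <= n -> k <= count (leq^~ k) w) (enough_small n w).
Proof.
apply: (iffP allP) => H k.
  by move=> kn; apply: H; rewrite mem_iota; lia.
by rewrite mem_iota => ?; apply: H; lia.
Qed.

Lemma enough_smallS n w :
  enough_small n.+1 w = enough_small n w && (n < count (leq^~ n.+1) w).
Proof.
by rewrite /enough_small -addn1 iotaD all_cat /= add0n andbT.
Qed.

Variant parking_space_spec (n : nat) (occ : seq nat) (a : nat) : option nat -> Prop :=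
  | ParkingSpaceSome k of 0 < k <= n & a <= k & k \notin occ
      & (forall j, 0 < j -> a <= j < k -> j \in occ) :
      parking_space_spec n occ a (Some k)
  | ParkingSpaceNone of (forall j, 0 < j <= n -> a <= j -> j \in occ) :
      parking_space_spec n occ a None.

Lemma parking_spaceP n occ a :
  parking_space_spec n occ a (parking_space n occ a).
Proof.
rewrite /parking_space.
set F := filter _ _.
have memF j : (j \in F) = [&& 0 < j <= n, a <= j & j \notin occ].
  by rewrite mem_filter mem_iota add1n ltnS andbC.
have : sorted ltn F by apply: sorted_filter; [exact: ltn_trans | exact: iota_ltn_sorted].
case: F memF => [|k r] memF sF /=.
  constructor => j jn aj; have := memF j; rewrite jn aj /= in_nil.
  by case: (j \in occ).
have := memF k; rewrite mem_head => /esym/and3P[kn ak kocc].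
constructor=> // j j0 /andP[aj jk].
have := memF j; rewrite aj j0 /=.
case: (boolP (j \in occ)) => // _; rewrite andbT inE.
have -> : j <= n by lia.
case/orP => [/eqP ?|jr]; first lia.
have := order_path_min ltn_trans sF => /allP/(_ _ jr) /=; lia.
Qed.

(** Pigeonhole: the [m] values of the interval are distinct, so a list containing all of them has at
    least [m] entries among them. *)
Lemma leq_count_interval (occ : seq nat) (p : pred nat) a m :
  (forall j, a <= j < a + m -> (j \in occ) && p j) -> m <= count p occ.
Proof.
move=> H; rewrite -(size_iota a m) -size_filter.
apply: uniq_leq_size; first exact: iota_uniq.
by move=> j; rewrite mem_iota mem_filter => /H /andP[-> ->].
Qed.

Lemma uniq_full_perm n (occ : seq nat) :
  uniq occ -> all (fun k => 0 < k <= n) occ -> size occ = n ->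
  perm_eq occ (iota 1 n).
Proof.
move=> U /allP B sz; apply: uniq_perm => //; first exact: iota_uniq.
have sub : {subset occ <= iota 1 n} by move=> k /B; rewrite mem_iota; lia.
by have [|_] := uniq_min_size U sub; first by rewrite size_iota sz.
Qed.

Lemma count_le_iota n k : k <= n -> count (leq^~ k) (iota 1 n) = k.
Proof.
move=> kn; have -> : n = k + (n - k) by lia.
rewrite iotaD count_cat.
have /eqP -> : count (leq^~ k) (iota 1 k) == k.
  rewrite -[X in _ == X](size_iota 1 k) -all_count.
  by apply/allP => j; rewrite mem_iota; lia.
rewrite -[RHS]addn0; congr (_ + _); apply/eqP; rewrite -leqn0 leqNgt -has_count.
by apply/hasPn => j; rewrite mem_iota; lia.
Qed.

(* Moving the arriving car from its preference to its actual space does not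
affect the counting condition on the occupied spaces together with the
remaining preferences. *)
Lemma all_park_enough_small n (occ w : seq nat) :
  uniq occ -> all (fun k => 0 < k <= n) (occ ++ w) ->
  size (occ ++ w) = n ->
  all_park n occ w = enough_small n (occ ++ w).
Proof.
elim: w occ => [|a w IHw] occ Uocc.
  rewrite cats0 /= => B sz; apply/esym/enough_smallP => k kn.
  by rewrite (permP (uniq_full_perm _ _ Uocc B sz)) count_le_iota.
rewrite all_cat /= => /and3P[Bocc /andP[a0 an] Bw].
rewrite size_cat /= => sz; case: parking_spaceP => [k kn ak kocc gap|full].
  rewrite IHw /=; last 3 first.
  - by rewrite kocc.
  - by rewrite kn all_cat Bocc.
  - by rewrite size_cat; lia.
  apply/enough_smallP/enough_smallP => H j jn; have := H j jn;
    rewrite /= !count_cat /=; first by lia.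
  have [kj|jk] := leqP k j; first by lia.
  have [ja|aj] := ltnP j a; first by lia.
  (* In the case [a <= j < k], at least [a.-1] letters are at most [a.-1], none of them the new
     car's, and the spaces [a, ..., j] skipped by that car supply the missing [j - a.-1]. *)
  have := H a.-1; rewrite /= !count_cat /= => Ha.
  have occ_split : count (leq^~ a.-1) occ + (j - a.-1) <= count (leq^~ j) occ.
    have -> : count (leq^~ j) occ
        = count (leq^~ a.-1) occ + count (fun x => a <= x <= j) occ.
      by elim: (occ) => //= x o ->; lia.
    rewrite leq_add2l; apply: (leq_count_interval _ _ a) => i ij.
    rewrite gap; lia.
  have w_mono : count (leq^~ a.-1) w <= count (leq^~ j) w.
    by apply: sub_count => x /=; lia.
  lia.
(* If the car finds no space, [a, ..., n] are all occupied; with the car itself this leaves at most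
   [a - 2] letters below [a], so the condition fails at [a.-1]. *)
apply/esym/negP => /enough_smallP /(_ a.-1).
rewrite count_cat /=.
have : n.+1 - a <= count (fun x => a <= x) occ.
  apply: (leq_count_interval _ _ a) => j ja; rewrite full; lia.
have : count (leq^~ a.-1) occ + count (fun x => a <= x) occ = size occ.
  by elim: (occ) => //= x o; lia.
have := count_size (leq^~ a.-1) w.
lia.
Qed.

(** * Counting words over a finite alphabet *)

Fixpoint num_words (A : seq nat) (m : nat) (P : pred (seq nat)) : nat :=
  if m is m'.+1 then \sum_(a <- A) num_words A m' (fun w => P (a :: w))
  else P [::].

Lemma eq_num_words A m (P Q : pred (seq nat)) :
  (forall w, size w = m -> {subset w <= A} -> P w = Q w) ->
  num_words A m P = num_words A m Q.
Proof.
elim: m P Q => [|m IHm] P Q PQ /=; first by rewrite PQ.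
rewrite big_seq [RHS]big_seq; apply: eq_bigr => a aA; apply: IHm => w sw wA.
apply: PQ => /=; first by rewrite sw.
by move=> x; rewrite inE => /orP[/eqP->|/wA].
Qed.

Lemma num_words_true A m : num_words A m xpredT = size A ^ m.
Proof.
elim: m => [|m IHm] //=; under eq_bigr do rewrite IHm.
by rewrite big_const_seq count_predT iter_addn_0 expnS mulnC.
Qed.

Lemma num_words_false A m (P : pred (seq nat)) :
  P =1 xpred0 -> num_words A m P = 0.
Proof.
elim: m P => [|m IHm] P P0 /=; first by rewrite P0.
by rewrite big1 // => a _; apply: IHm => w; rewrite P0.
Qed.

Lemma num_words_all A m (p : pred nat) (P : pred (seq nat)) :
  num_words A m (fun w => P w && all p w) = num_words (filter p A) m P.
Proof.
elim: m P => [|m IHm] P /=; first by rewrite andbT.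
rewrite big_filter [LHS](bigID p) /= [X in _ + X]big1 ?addn0.
  by apply: eq_bigr => a pa; rewrite -IHm; apply: eq_num_words => w _ _; rewrite pa.
by move=> a /negbTE pa; apply: num_words_false => w; rewrite pa /= andbF.
Qed.

(** With booleans read as 0 or 1, the hypothesis says that exactly one of [P], [B 0], ..., [B N.-1]
    holds at each word; it is then summed over all words. *)
Lemma num_words_partition A m N (P : pred (seq nat)) (B : nat -> pred (seq nat)) :
  (forall w, size w = m -> {subset w <= A} ->
    P w + \sum_(0 <= i < N) B i w = 1) ->
  num_words A m P + \sum_(0 <= i < N) num_words A m (B i) = size A ^ m.
Proof.
move=> H; rewrite -num_words_true.
elim: m P B H => [|m IHm] P B H /=; first by rewrite H.
rewrite exchange_big /= -big_split /= big_seq [RHS]big_seq.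
apply: eq_bigr => a aA; apply: IHm => w sw wA; apply: H => /=.
  by rewrite sw.
by move=> x; rewrite inE => /orP[/eqP->|/wA].
Qed.

(* The binomial coefficient places the letters satisfying p. *)
Lemma num_words_filter A m i (p : pred nat) (P : pred (seq nat)) :
  num_words A m (fun w => P (filter p w) && (count p w == i))
  = 'C(m, i) * num_words (filter p A) i P * count (predC p) A ^ (m - i).
Proof.
elim: m i P => [|m IHm] i P /=.
  by case: i => [|i]; rewrite ?andbF ?andbT ?bin0 ?mul1n ?muln1.
(* Splitting on whether the first letter satisfies [p] gives the two terms of Pascal's rule. *)
rewrite (bigID p) /= [X in _ + X](_ : _ =
    count (predC p) A * ('C(m, i) * num_words (filter p A) i P
                         * count (predC p) A ^ (m - i))); last first.
  under eq_bigr => a /negbTE pa.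
    under eq_num_words do rewrite pa add0n.
    rewrite IHm; over.
  by rewrite big_const_seq iter_addn_0 mulnC.
case: i => [|i].
  rewrite big1 ?add0n; last first.
    by move=> a pa; apply: num_words_false => w; rewrite pa andbF.
  by rewrite !bin0 !subn0 expnS; lia.
under eq_bigr => a pa.
  rewrite (eq_num_words _ _ _ (fun w => P (a :: filter p w) && (count p w == i)));
    last by move=> w _ _; rewrite pa.
  rewrite (IHm _ (fun w => P (a :: w))); over.
rewrite -big_distrl -big_distrr /= -big_filter.
set S := \sum_(_ <- _) _; rewrite binS subSS.
(* For [m <= i] the exponent [m - i.+1] is truncated, but then ['C(m, i.+1)] vanishes. *)
have [im|mi] := ltnP i m.
  have -> : m - i = (m - i.+1).+1 by lia.
  by rewrite expnS; lia.
by rewrite (bin_small (_ : m < i.+1)) //; lia.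
Qed.

(** * Parking numbers as word counts *)

Lemma card_tuple_num_words n m (P : pred (seq nat)) :
  #|[set t : m.-tuple 'I_n | P [seq (val x).+1 | x <- t]]|
  = num_words (iota 1 n) m P.
Proof.
elim: m P => [|m IHm] P.
  rewrite cardsE -sum1_card big_mkcond /= (big_pred1 [tuple]) => [|t].
    by rewrite unfold_in /=; case: (P [::]).
  by apply/esym/eqP; rewrite (tuple0 t).
transitivity (\sum_(a : 'I_n) num_words (iota 1 n) m (fun w => P (a.+1 :: w))).
  under eq_bigr do rewrite -IHm cardsE -sum1_card.
  rewrite cardsE -sum1_card pair_big_dep /=.
  rewrite (reindex (fun q : 'I_n * m.-tuple 'I_n => [tuple of q.1 :: q.2])) /=.
    by apply: eq_bigl => -[a t]; rewrite !unfold_in.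
  exists (fun t => (thead t, [tuple of behead t])) => [[a t]|t] _ /=.
    by rewrite theadE; congr (_, _); apply: val_inj.
  by rewrite -tuple_eta.
rewrite /= -(big_mkord xpredT (fun a => num_words _ _ (fun w => P (a.+1 :: w)))).
by rewrite (iotaDl 1 0) big_map /index_iota subn0.
Qed.

Lemma parking_functionE n (t : n.-tuple 'I_n) :
  parking_function t = enough_small n (preferences t).
Proof.
apply: all_park_enough_small => //=; last by rewrite size_map size_tuple.
by apply/allP => _ /mapP[x _ ->] /=; apply: ltn_ord.
Qed.

Lemma num_pfE n : num_pf n = num_words (iota 1 n) n (enough_small n).
Proof.
rewrite -card_tuple_num_words; apply: eq_card => t.
by rewrite !inE parking_functionE.
Qed.

Lemma num_words_head A n l (P : pred (seq nat)) :
  uniq A -> l \in A ->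
  num_words A n.+1 (fun w => P w && (head 0 w == l))
  = num_words A n (fun w => P (l :: w)).
Proof.
move=> UA lA /=; rewrite (bigD1_seq l) //= big1 ?addn0.
  by apply: eq_num_words => w _ _; rewrite eqxx andbT.
by move=> a /negbTE al; apply: num_words_false => w; rewrite al andbF.
Qed.

Lemma num_pf_firstE n l : 0 < l <= n ->
  num_pf_first n l = num_words (iota 1 n) n.-1 (fun w => enough_small n (l :: w)).
Proof.
case: n => [|n] ln; first lia.
rewrite -num_words_head ?iota_uniq ?mem_iota; [|lia..].
rewrite -card_tuple_num_words; apply: eq_card => t.
by rewrite !inE parking_functionE.
Qed.

Lemma filter_le_iota n s : s <= n -> filter (leq^~ s) (iota 1 n) = iota 1 s.
Proof.
move=> sn; have -> : n = s + (n - s) by lia.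
rewrite iotaD filter_cat.
rewrite (_ : filter _ (iota (1 + s) _) = [::]) ?cats0.
  by apply/all_filterP/allP => j; rewrite mem_iota; lia.
by apply/eqP; rewrite -[_ == _]negbK -has_filter; apply/hasPn => j; rewrite mem_iota; lia.
Qed.

Lemma num_pf_first_leE n s l : 0 < l <= s -> s <= n ->
  num_pf_first_le n s l
  = num_words (iota 1 s) n.-1 (fun w => enough_small n (l :: w)).
Proof.
case: n => [|n] ls sn; first lia.
rewrite -num_words_head ?iota_uniq ?mem_iota; [|lia..].
rewrite -(filter_le_iota _ _ sn) -num_words_all -card_tuple_num_words.
by apply: eq_card => t; rewrite !inE parking_functionE andbA.
Qed.

(** * Classification of words by their first failure *)

(* [i.+1] is the least [k] with fewer than [k] letters [<= k]. *)
Definition fails_after (i : nat) (w : seq nat) : bool :=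
  enough_small i w && (count (leq^~ i.+1) w == i).

(** The sum telescopes: a word satisfying the condition up to [N] either satisfies it at [N.+1] too
    or has exactly [N] letters [<= N.+1]. *)
Lemma enough_small_or_fails N w :
  enough_small N w + \sum_(0 <= i < N) fails_after i w = 1.
Proof.
elim: N => [|N IHN]; first by rewrite big_geq // /enough_small.
rewrite big_nat_recr //= [X in _ + X]addnC addnA -[RHS]IHN; congr (_ + _).
rewrite enough_smallS /fails_after.
case: enough_smallP => //= /(_ N (leqnn N)) H.
have : count (leq^~ N) w <= count (leq^~ N.+1) w by apply: sub_count => x /=; lia.
lia.
Qed.

(** At least [i] letters are [<= i] and exactly [i] are [<= i.+1], so none equals [i.+1]. This form
    separates small letters, forbidden letter and large letters for [num_words_filter] and
    [num_words_all]. *)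
Lemma fails_afterE i w :
  fails_after i w = (enough_small i (filter (leq^~ i) w)
                     && (count (leq^~ i) w == i)) && all (predC1 i.+1) w.
Proof.
have -> : enough_small i (filter (leq^~ i) w) = enough_small i w.
  apply: eq_in_all => k; rewrite mem_iota => ki; rewrite count_filter.
  by congr (_ <= _); apply: eq_count => x /=; lia.
rewrite /fails_after -andbA; case: enough_smallP => //= /(_ i (leqnn i)) H.
have -> : count (leq^~ i.+1) w = count (leq^~ i) w + count_mem i.+1 w.
  by elim: (w) => //= x o ->; lia.
have -> : all (predC1 i.+1) w = (count_mem i.+1 w == 0).
  by rewrite (all_predC (pred1 i.+1)) has_count lt0n negbK.
lia.
Qed.

Lemma filter_le_neq_iota i s : i < s ->
  filter (leq^~ i) (filter (predC1 i.+1) (iota 1 s)) = iota 1 i.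
Proof.
move=> si; rewrite -(filter_le_iota s i) -?filter_predI; last lia.
by apply: eq_filter => x /=; lia.
Qed.

Lemma count_gt_neq_iota i s : i < s ->
  count (predC (leq^~ i)) (filter (predC1 i.+1) (iota 1 s)) = s - i - 1.
Proof.
move=> si; rewrite count_filter.
have := count_predC (leq^~ i.+1) (iota 1 s).
rewrite size_iota count_le_iota // => H.
rewrite (eq_count (a2 := predC (leq^~ i.+1))); first lia.
by move=> x /=; lia.
Qed.

(** Here [l] is a large letter, so all [i] small letters are placed among the [n] positions after
    the first. *)
Lemma num_fails_after_lt n s l i : i < s -> i < l.-1 ->
  num_words (iota 1 s) n (fun w => fails_after i (l :: w))
  = 'C(n, i) * num_pf i * (s - i - 1) ^ (n - i).
Proof.
move=> si il.
rewrite num_pfE -(filter_le_neq_iota i s si) -(count_gt_neq_iota i s si).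
rewrite -num_words_filter -num_words_all; apply: eq_num_words => w _ _.
rewrite fails_afterE /=.
by have [-> ->] : (l <= i) = false /\ l != i.+1 by split; lia.
Qed.

(** Here [l] is itself a small letter, so only [i.-1] small letters remain to be placed, and
    together with [l] they form a parking function starting with [l]. *)
Lemma num_fails_after_ge n s l i : i < s -> 0 < l <= i ->
  num_words (iota 1 s) n (fun w => fails_after i (l :: w))
  = 'C(n, i.-1) * num_pf_first i l * (s - i - 1) ^ (n - i.-1).
Proof.
move=> si li.
rewrite num_pf_firstE // -[in num_words (iota 1 i)](filter_le_neq_iota i s si).
rewrite -(count_gt_neq_iota i s si).
rewrite -(num_words_filter _ _ _ _ (fun w => enough_small i (l :: w))).
rewrite -num_words_all; apply: eq_num_words => w _ _.
rewrite fails_afterE /=.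
have [-> ->] : (l <= i) = true /\ l != i.+1 by split; lia.
by rewrite /=; congr (_ && _ && _); lia.
Qed.

(** The forbidden letter is [l] itself; hence the gap at [i = l - 1] between the two sums. *)
Lemma num_fails_after_eq A n l : 0 < l ->
  num_words A n (fun w => fails_after l.-1 (l :: w)) = 0.
Proof.
move=> l0; apply: num_words_false => w.
by rewrite fails_afterE prednK //= eqxx andbF.
Qed.

(** For [k >= s] all [n] letters are counted, so only thresholds below [s] matter; this is why the
    sums stop at [s - 2]. *)
Lemma enough_small_bounded n s w : size w = n -> s <= n ->
  all (leq^~ s) w -> enough_small n w = enough_small s.-1 w.
Proof.
move=> sw sn /allP ws; apply/enough_smallP/enough_smallP => H k kn.
  by apply: H; lia.
have [ks|sk] := leqP k s.-1; first exact: H.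
suff -> : count (leq^~ k) w = size w by lia.
by apply/eqP; rewrite -all_count; apply/allP => x /ws; lia.
Qed.

(** The identity is stated additively in [nat], which avoids truncated subtraction of the sums. *)
Lemma num_pf_first_le_add n s l : 0 < l <= s -> s <= n ->
  num_pf_first_le n s l
  + (\sum_(0 <= i < l - 1) 'C(n - 1, i) * num_pf i * (s - i - 1) ^ (n - i - 1)
     + \sum_(l <= i < s - 1)
         'C(n - 1, i - 1) * num_pf_first i l * (s - i - 1) ^ (n - i))
  = s ^ (n - 1).
Proof.
move=> ls sn; rewrite num_pf_first_leE // -subn1.
rewrite -[in RHS](size_iota 1 s).
rewrite -(num_words_partition _ _ (s - 1) (fun w => enough_small n (l :: w))
            (fun i w => fails_after i (l :: w))); last first.
  move=> w sw ws; rewrite -[RHS](enough_small_or_fails (s - 1) (l :: w)).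
  have szlw : size (l :: w) = n by rewrite /= sw; lia.
  rewrite (enough_small_bounded n s _ szlw sn) ?subn1 //=.
  by apply/andP; split; [lia | apply/allP => x /ws; rewrite mem_iota; lia].
congr (_ + _).
rewrite [RHS](_ : _ = \sum_(0 <= i < l - 1)
      num_words (iota 1 s) (n - 1) (fun w => fails_after i (l :: w))
    + \sum_(l <= i < s - 1)
      num_words (iota 1 s) (n - 1) (fun w => fails_after i (l :: w))).
  congr (_ + _); rewrite big_nat [RHS]big_nat; apply: eq_bigr => i ib.
    rewrite num_fails_after_lt; [|lia..].
    by congr (_ * _ ^ _); lia.
  rewrite num_fails_after_ge; [|lia..].
  by rewrite -subn1; congr (_ * _ ^ _); lia.
(* For [s = l] the second sum is empty; otherwise the range is cut at [l - 1], whose term is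
   zero. *)
have [sl|ls'] := leqP s l.
  have -> : s = l by lia.
  by rewrite [X in _ = _ + X]big_geq ?addn0 //; lia.
rewrite (big_cat_nat (n := l - 1)) /=; [|lia..].
congr (_ + _); rewrite big_ltn; last lia.
rewrite [l - 1]subn1 num_fails_after_eq ?add0n ?prednK //; lia.
Qed.

(** * Transfer to the integers *)

Local Open Scope ring_scope.

Theorem theorem2p11 (n s l : nat)
    (hl : (1 <= l)%N) (hls : (l <= s)%N) (hsn : (s <= n)%N) :
  (num_pf_first_le n s l)%:Z =
    s%:Z ^+ (n - 1)
    - \sum_(0 <= i < l - 1)
        'C(n - 1, i)%:Z * (num_pf i)%:Z * (s%:Z - i%:Z - 1) ^+ (n - i - 1)
    - \sum_(l <= i < s - 1)
        'C(n - 1, i - 1)%:Z * (num_pf_first i l)%:Z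
          * (s%:Z - i%:Z - 1) ^+ (n - i).
Proof.
(* All indices in both sums are below [s], so natural and integer subtraction agree in the bases of
   the powers. *)
have subz i : (i < s)%N -> s%:Z - i%:Z - 1 = (s - i - 1)%N%:Z.
  by move=> si; rewrite -!subzn; lia.
have ls : (0 < l <= s)%N by rewrite hl.
have -> : s%:Z ^+ (n - 1) = (s ^ (n - 1))%N%:Z by rewrite -!natz natrX.
rewrite -(num_pf_first_le_add _ _ _ ls hsn) !PoszD -addrA -opprD.
rewrite -!natz !natr_sum !natz.
set X := \sum_(0 <= i < _) _; set Y := \sum_(l <= i < _) _.
set X' := \sum_(0 <= i < _) _; set Y' := \sum_(l <= i < _) _.
suff [-> ->] : X' = X /\ Y' = Y by rewrite addrK.
split; rewrite /X /X' /Y /Y' big_nat [RHS]big_nat; apply: eq_bigr => i ib.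
  by rewrite subz; [rewrite -!natz !natrM natrX !natz | lia].
by rewrite subz; [rewrite -!natz !natrM natrX !natz | lia].
Qed.
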